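(* Let $a\in\mathbb R$ and $b>0$, and let $F$ be a bi-atomic distribution with mean $1$ supported on $\{a,a+b\}$. Then $F\in\mathcal D_2^{\mathrm U}$ if and only if $1/b\in\mathbb N$.
   Context: $\mathbb N=\{1,2,\dots\}$. A bi-atomic distribution supported on $\{a,a+b\}$ is a probability distribution concentrated on these two points that assigns strictly positive mass to each of them. $\mathcal D_2^{\mathrm U}$ is the set of all distributions of $X_1+X_2$, where $X_1,X_2$ are random variables on a common atomless probability space, each uniformly distributed on $[0,1]$, with arbitrary joint distribution. *)

(* Defs.v *)
From mathcomp Require Import all_boot all_order all_algebra.
From mathcomp Require Import all_classical all_reals all_analysis.
From mathcomp Require Import measurable_realfun.

Set Implicit Arguments.
Unset Strict Implicit.
Unset Printing Implicit Defensive.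

Import Order.TTheory GRing.Theory Num.Theory.
Import numFieldNormedType.Exports.

Local Open Scope classical_set_scope.
Local Open Scope ring_scope.
Local Open Scope ereal_scope.

Definition atomless (R : realType) (d : measure_display) (T : measurableType d)
    (P : probability T R) : Prop :=
  forall A : set T, measurable A -> 0 < P A ->
  exists B : set T, [/\ measurable B, B `<=` A, 0 < P B & P B < P A].

(** Laws are compared on Borel sets only: as functions on arbitrary sets,
    measures carry meaningless values outside the sigma-algebra. *)
Definition has_law (R : realType) (d : measure_display) (T : measurableType d)
    (P : probability T R) (X : {RV P >-> R}) (mu : set R -> \bar R) : Prop :=
  forall A : set R, measurable A -> distribution P X A = mu A.

Arguments has_law {R d T} P X mu.

Definition uniform01 (R : realType) (d : measure_display) (T : measurableType d)
    (P : probability T R) (X : {RV P >-> R}) : Prop :=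
  has_law P X (uniform_prob (@ltr01 R)).

Arguments uniform01 {R d T} P X.

Definition DU2 (R : realType) : set (probability R R) :=
  [set F | exists (d : measure_display) (T : measurableType d)
                  (P : probability T R) (X1 X2 : {RV P >-> R}),
     [/\ atomless P, uniform01 P X1, uniform01 P X2 &
         has_law P (X1 \+ X2)%R F]].

Arguments DU2 R : clear implicits.

Definition bi_atomic (R : realType) (F : probability R R) (x y : R) : Prop :=
  [/\ x != y, F [set x; y] = 1, 0 < F [set x] & 0 < F [set y]].

(* Main.v *)
Require Import Defs.
From mathcomp Require Import all_boot all_order all_algebra.
From mathcomp Require Import all_classical all_reals all_analysis.
From mathcomp Require Import measurable_realfun.
From mathcomp Require Import ring lra zify.
Import Order.TTheory GRing.Theory Num.Theory.
Import numFieldNormedType.Exports.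
Local Open Scope classical_set_scope.
Local Open Scope ring_scope.
Set Implicit Arguments.
Unset Strict Implicit.

(** Necessity. The mean condition gives [0 < 1 - a < b]. Put [k = 2 pi / b] and
    [V_i = X_i - 1 / 2]. Since [X1 + X2] takes the values [a] and [a + b] only,
    [k V_1 = k (a - 1) - k V_2] modulo [2 pi]. As [E sin (k V_2) = 0], taking
    expectations of cosines yields [C = cos (k (a - 1)) C] for the common value
    [C = E cos (k V_i) = 2 sin (k / 2) / k]. The first factor is not [1], so
    [sin (pi / b) = 0], i.e. [1 / b] is an integer.

    Sufficiency. Let [b = 1 / n] and cut the line into blocks of length [b].
    Take [X1] to be the identity on [[0, 1[] and [X2 x] whichever of [a - x] and
    [a + b - x] lies in the block that mirrors the block of [x]. This is an
    involution that is piecewise a reflection, hence preserves Lebesgue measure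
    on [[0, 1[]. Finally, a law carried by two given points is determined by
    its mean, and [E (X1 + X2) = 1]. *)

(** * Change of variables and integrals of uniform variables *)

Lemma integral_pushforward_eq {R : realType} {d d' : measure_display}
    {T : measurableType d} {T' : measurableType d'}
    (P : {measure set T -> \bar R}) (X : T -> T')
    (mu : {measure set T' -> \bar R}) (f : T' -> \bar R) :
  measurable_fun setT X -> (forall A, measurable A -> P (X @^-1` A) = mu A) ->
  measurable_fun setT f ->
  (\int[P]_w f (X w) = \int[mu]_x f x)%E.
Proof.
move=> mX Xmu mf.
have ge0 (g : T' -> \bar R) : measurable_fun setT g -> (forall x, 0 <= g x)%E ->
    (\int[P]_w g (X w) = \int[mu]_x g x)%E.
  move=> mg g0; rewrite -(ge0_integral_pushforward mX P measurableT)//.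
  by apply: eq_measure_integral => A mA _; exact: Xmu.
(* The signed case follows by transporting the positive and negative parts separately. *)
rewrite integralE [RHS]integralE -ge0//; last exact: measurable_funepos.
by rewrite -ge0; [rewrite funepos_comp funeneg_comp|exact: measurable_funeneg|].
Qed.

Section uniform_laws.
Context {R : realType} {d : measure_display} {T : measurableType d}.
Context (P : probability T R).
Local Open Scope ereal_scope.

Lemma integral_uniform01 (f : R -> \bar R) : measurable_fun setT f ->
  \int[uniform_prob (@ltr01 R)]_x f x =
  \int[lebesgue_measure]_(x in `[0%R, 1%R]) f x.
Proof.
move=> mf; rewrite integralE [RHS]integralE !integral_uniform//.
- by rewrite subr0 invr1 !mul1e.
- exact: measurable_funeneg.
- exact: measurable_funepos.
Qed.

(** [uniform_prob] lives on [measurableTypeR R], which has the same measurable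
    sets as [R] but a different display. *)
Lemma integral_law_uniform01 (X : {RV P >-> R}) (f : R -> \bar R) :
  uniform01 P X -> measurable_fun setT f ->
  \int[P]_w f (X w) = \int[lebesgue_measure]_(x in `[0%R, 1%R]) f x.
Proof.
move=> uX mf; rewrite -integral_uniform01//.
exact: (integral_pushforward_eq (T' := measurableTypeR R)
  (measurable_funPT X) uX).
Qed.

Lemma expectation_uniform01 (X : {RV P >-> R}) (f : R -> R) :
  uniform01 P X -> measurable_fun setT f ->
  'E_P[f \o X] = \int[lebesgue_measure]_(x in `[0%R, 1%R]) (f x)%:E.
Proof.
move=> uX mf; rewrite unlock (integral_law_uniform01 (f := EFin \o f) uX)//.
exact/measurable_EFinP.
Qed.

(** The uniform law is carried by a compact segment, on which a continuous function is
    integrable. *)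
Lemma Lfun1_uniform01 (X : {RV P >-> R}) (f : R -> R) :
  uniform01 P X -> continuous f -> (f \o X : T -> R) \in Lfun P 1.
Proof.
move=> uX cf.
have mf : measurable_fun setT f by exact: continuous_measurable_fun.
apply/Lfun1_integrable/integrableP; split.
  by apply/measurable_EFinP; exact: measurableT_comp.
have mEf : measurable_fun setT (fun x => `|(f x)%:E|).
  by apply: measurableT_comp => //; exact/measurable_EFinP.
rewrite (integral_law_uniform01 (f := fun x => `|(f x)%:E|) uX)//.
by have /integrableP[] := @continuous_compact_integrable R f `[0%R, 1%R]
  (@segment_compact _ _ _) (continuous_subspaceT cf).
Qed.

End uniform_laws.

(** * Explicit integrals over the unit interval *)

Section primitives.
Context {R : realType}.

Lemma integral01_primitive (f F : R -> R) : continuous f ->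
  (forall x : R, is_derive x (1 : R) F (f x)) ->
  (\int[lebesgue_measure]_(x in `[0%R, 1%R]) (f x)%:E = (F 1 - F 0)%:E)%E.
Proof.
move=> cf dF.
have cF : continuous F.
  move=> x; apply/differentiable_continuous; rewrite -derivable1_diffP.
  by have [] := dF x.
rewrite (@continuous_FTC2 _ f F)//.
- exact: continuous_subspaceT.
- split; first by move=> x _; have [] := dF x.
  + exact/cvg_at_right_filter/cF.
  + exact/cvg_at_left_filter/cF.
- by move=> x _; rewrite derive1E; have [_ ->] := dF x.
Qed.

Lemma integral01_id :
  (\int[lebesgue_measure]_(x in `[0%R, 1%R]) x%:E = (1 / 2 : R)%:E)%E.
Proof.
have dF (x : R) : is_derive x (1 : R) (fun x : R => x ^+ 2 / 2) x.
  by apply: is_derive_eq; rewrite /GRing.scale/=; field.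
rewrite (integral01_primitive (f := id) _ dF); last by move=> x; exact: cvg_id.
by congr EFin; field.
Qed.

Lemma continuous_centered (k : R) : continuous (fun x : R => k * (x - 1 / 2)).
Proof.
move=> x; apply: cvgM; first exact: cvg_cst.
by apply: cvgB; [exact: cvg_id|exact: cvg_cst].
Qed.

Lemma integral01_cos (k : R) : k != 0 ->
  (\int[lebesgue_measure]_(x in `[0%R, 1%R]) (cos (k * (x - 1 / 2)))%:E
   = (2 * sin (k / 2) / k)%:E)%E.
Proof.
move=> k0.
have dF (x : R) : is_derive x (1 : R) (fun x => sin (k * (x - 1 / 2)) / k)
    (cos (k * (x - 1 / 2))).
  by apply: is_derive_eq; rewrite /GRing.scale/=; field.
rewrite (integral01_primitive (f := fun x => cos (k * (x - 1 / 2))) _ dF).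
- congr EFin.
  have -> : k * (1 - 1 / 2) = k / 2 by field.
  have -> : k * (0 - 1 / 2) = - (k / 2) by field.
  by rewrite sinN; field.
- move=> x; apply: continuous_comp; first exact: continuous_centered.
  exact: continuous_cos.
Qed.

(** Centering at [1 / 2] makes the endpoint arguments opposite, and the primitive [- cos / k] takes
    the same value at both because [cos] is even. *)
Lemma integral01_sin (k : R) : k != 0 ->
  (\int[lebesgue_measure]_(x in `[0%R, 1%R]) (sin (k * (x - 1 / 2)))%:E = 0)%E.
Proof.
move=> k0.
have dF (x : R) : is_derive x (1 : R) (fun x => - cos (k * (x - 1 / 2)) / k)
    (sin (k * (x - 1 / 2))).
  by apply: is_derive_eq; rewrite /GRing.scale/=; field.
rewrite (integral01_primitive (f := fun x => sin (k * (x - 1 / 2))) _ dF).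
- congr EFin.
  have -> : k * (1 - 1 / 2) = k / 2 by field.
  have -> : k * (0 - 1 / 2) = - (k / 2) by field.
  by rewrite cosN subrr.
- move=> x; apply: continuous_comp; first exact: continuous_centered.
  exact: continuous_sin.
Qed.

End primitives.

(** * Zeros of the sine and maxima of the cosine *)

Section trigonometry.
Context {R : realType}.

(** Removing the integer part [n] of [y] changes [sin (pi * y)] only by a sign, and [sin] is
    positive on the open interval from [0] to [pi]; hence the fractional part vanishes. *)
Lemma sin_pi_nat (y : R) : 0 < y -> sin (pi * y) = 0 ->
  exists n : nat, (0 < n)%N /\ y = n%:R.
Proof.
move=> y0 sy; have /andP[ny yn] := truncn_itv (ltW y0).
set n := Num.trunc y in ny yn.
have sf : sin (pi * (y - n%:R)) = 0.
  move: sy; rewrite -{1}(subrK n%:R y) mulrDr mulr_natr.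
  rewrite (alternatingn (@sinDpi R)) => /eqP.
  by rewrite mulf_eq0 signr_eq0/= => /eqP.
have pi0 := pi_gt0 R.
have yE : y = n%:R.
  apply/eqP; rewrite eq_le ny andbT leNgt; apply/negP => ny'.
  have := @sin_gt0_pi R (pi * (y - n%:R)).
  rewrite sf ltxx => W; apply/notF/W; rewrite mulr_gt0 ?subr_gt0// => /=.
  by rewrite -[ltRHS]mulr1 ltr_pM2l// ltrBlDl natr1.
by exists n; rewrite -(ltr0n R) -yE.
Qed.

(** By the half-angle formula [cos x = 1 - 2 * sin (x / 2) ^+ 2], where [x / 2] lies strictly
    between [0] and [pi]. *)
Lemma cos_lt1 (x : R) : 0 < x < 2 * pi -> cos x < 1.
Proof.
move=> /andP[x0 xpi].
have s0 : 0 < sin (x / 2) by apply: sin_gt0_pi; apply/andP; split; lra.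
have -> : x = (x / 2) *+ 2 by rewrite -mulr_natr; field.
have /= := cos_mulr2n (x / 2).
have := cos2Dsin2 (x / 2).
nra.
Qed.

End trigonometry.

(** * Laws carried by two points *)

Section two_points.
Context {R : realType}.
Local Open Scope ereal_scope.

Lemma two_point_left (mu : probability R R) (x y : R) : x != y ->
  mu [set x; y] = 1 -> mu [set x] = 1 - mu [set y].
Proof.
move=> xy mu1; rewrite -mu1 measureU//.
  by rewrite addeK// fin_num_measure.
by apply/seteqP; split => // z [/= -> /eqP]; rewrite (negbTE xy).
Qed.

(** The mass of [A] equals that of its trace on the two points, and total mass [1] makes one atom
    determine the other. *)
Lemma two_point_eq (mu nu : probability R R) (x y : R) : x != y ->
  mu [set x; y] = 1 -> nu [set x; y] = 1 -> mu [set y] = nu [set y] ->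
  forall A, measurable A -> mu A = nu A.
Proof.
move=> xy mu1 nu1 muy A mA.
have mux : mu [set x] = nu [set x].
  by rewrite (two_point_left xy mu1) (two_point_left xy nu1) muy.
have restr (m : probability R R) :
    m [set x; y] = 1 -> m A = m (A `&` [set x; y]).
  move=> m1; apply/eqP; rewrite eq_le; apply/andP; split.
    apply: (@le_trans _ _ (m (A `&` [set x; y]) + m (~` [set x; y]))).
      rewrite -measureU//.
      - rewrite le_measure// ?inE//.
        + by apply: measurableU; [apply: measurableI|apply: measurableC];
            rewrite //; exact: measurableU.
        + move=> z Az; have [] := pselect ([set x; y] z); by [left|right].
      - by apply: measurableI => //; exact: measurableU.
      - by apply: measurableC; exact: measurableU.
      - by rewrite -setIA setICr setI0.
    rewrite probability_setC ?m1 ?subee ?adde0//; exact: measurableU.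
  rewrite le_measure ?inE//; apply: measurableI => //; exact: measurableU.
rewrite (restr mu)// (restr nu)//.
have [Ax|Ax] := pselect (A x); have [Ay|Ay] := pselect (A y).
- by rewrite setIidr ?mu1 ?nu1// => z [->|->].
- suff -> : A `&` [set x; y] = [set x] by [].
  apply/seteqP; split => [z [Az [//|zy]]|z ->]; last by split; [|left].
  by move: Az; rewrite zy.
- suff -> : A `&` [set x; y] = [set y] by [].
  apply/seteqP; split => [z [Az [zx|//]]|z ->]; last by split; [|right].
  by move: Az; rewrite zx.
- suff -> : A `&` [set x; y] = set0 by rewrite !measure0.
  by apply/seteqP; split => [z [Az [zx|zx]]|z []]; move: Az; rewrite zx.
Qed.

(** The identity agrees almost everywhere with [a] plus [b] times the indicator of [a + b]. *)
Lemma two_point_mean (mu : probability R R) (a b : R) :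
  mu [set a; (a + b)%R] = 1 ->
  'E_mu[id] = a%:E + b%:E * mu [set (a + b)%R].
Proof.
move=> mu1.
have mS : measurable [set a; (a + b)%R] by exact: measurableU.
pose g : R -> R := (cst a \+ b \o* \1_[set (a + b)%R])%R.
have Lind : (\1_[set (a + b)%R] : R -> R) \in Lfun mu 1.
  by apply/Lfun1_integrable; apply: integrable_indic.
have mg : measurable_fun setT g.
  by apply: measurable_funD => //; apply: measurable_funM.
rewrite -(expectation_indic mu (measurable_set1 _)) -expectationZl//.
rewrite -(expectation_cst mu) -expectationD//; last 2 first.
- exact: Lfun_cst.
- by apply: Lfun_scale.
rewrite unlock; apply: ae_eq_integral => //=.
- exact/measurable_EFinP.
exists (~` [set a; (a + b)%R]); split.
- exact: measurableC.
- by rewrite /= probability_setC ?mu1 ?subee.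
- move=> z /= h; apply: contra_not h => zab _; rewrite indicE /=.
  have [->|zb] := eqVneq z (a + b)%R; first by rewrite mem_set//= mul1r.
  rewrite memNset/=; last by move/eqP; rewrite (negbTE zb).
  by case: zab => [->|/eqP]; rewrite ?mul0r ?addr0// (negbTE zb).
Qed.

End two_points.

(** * Necessity: the trigonometric obstruction *)

Section sum_of_uniforms.
Context {R : realType} {d : measure_display} {T : measurableType d}.
Variable P : probability T R.

Lemma two_point_sum_sin_eq0 (X1 X2 : {RV P >-> R}) (a b : R) :
  0 < 1 - a < b -> uniform01 P X1 -> uniform01 P X2 ->
  P [set w | [set a; a + b] (X1 w + X2 w)] = 1%E -> sin (pi / b) = 0.
Proof.
move=> /andP[a1 ab] u1 u2 P1.
have b0 : b != 0 by rewrite gt_eqF// (lt_trans a1).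
have pi0 := pi_gt0 R.
pose k : R := 2 * pi / b; pose C : R := 2 * sin (k / 2) / k.
have k0 : k != 0 by rewrite /k mulf_neq0 ?invr_eq0// mulf_neq0// gt_eqF.
pose c : R -> R := fun x => cos (k * (x - 1 / 2)).
pose s : R -> R := fun x => sin (k * (x - 1 / 2)).
have cc : continuous c.
  move=> x; apply: continuous_comp; first exact: continuous_centered.
  exact: continuous_cos.
have cs : continuous s.
  move=> x; apply: continuous_comp; first exact: continuous_centered.
  exact: continuous_sin.
have mc := continuous_measurable_fun cc.
have ms := continuous_measurable_fun cs.
have Ec (X : {RV P >-> R}) : uniform01 P X -> ('E_P[c \o X] = C%:E)%E.
  by move=> uX; rewrite expectation_uniform01// integral01_cos.
have Es (X : {RV P >-> R}) : uniform01 P X -> ('E_P[s \o X] = 0)%E.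
  by move=> uX; rewrite expectation_uniform01// integral01_sin.
pose u := cos (k * (a - 1)); pose v := sin (k * (a - 1)).
have E1 : ('E_P[c \o X1] = 'E_P[u \o* (c \o X2) \+ v \o* (s \o X2)])%E.
  rewrite unlock; apply: ae_eq_integral => //=.
  - by apply/measurable_EFinP; exact: measurableT_comp.
  - apply/measurable_EFinP; apply: measurable_funD;
      apply: measurable_funM => //;
      exact: measurableT_comp.
  have mS : measurable [set w | [set a; a + b] (X1 w + X2 w)].
    have := measurable_funD (measurable_funPT X1) (measurable_funPT X2).
    move=> /(_ measurableT [set a; a + b]); rewrite setTI; apply.
    exact: measurableU.
  exists (~` [set w | [set a; a + b] (X1 w + X2 w)]); split.
  - exact: measurableC.
  - by rewrite /= probability_setC ?P1 ?subee.
  move=> w /= h; apply: contra_not h => h _; congr EFin.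
  rewrite [RHS](_ : _ = cos (k * (a - 1) - k * (X2 w - 1 / 2))); last first.
    by rewrite cosB /c /s /u /v /=; congr (_ + _); exact: mulrC.
  rewrite /c /=.
  case: h => h.
    by congr cos; rewrite -h; field.
  (* At the value [a + b] the two arguments differ by [k * b = 2 * pi], a full period. *)
  rewrite -[in RHS]cosD2pi; congr cos.
  have -> : X1 w = a + b - X2 w by rewrite -h addrK.
  by rewrite /k -mulr_natl; field.
have Lc := Lfun1_uniform01 u2 cc.
have Ls := Lfun1_uniform01 u2 cs.
move: E1; rewrite Ec// expectationD; last 2 first.
- exact: Lfun_scale.
- exact: Lfun_scale.
rewrite !expectationZl// Ec// Es// mule0 adde0 -EFinM => -[] CE.
have u1' : u < 1.
  (* The mean bounds [0 < 1 - a < b] place [k * (1 - a)] strictly between [0] and [2 * pi]. *)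
  rewrite /u -cosN; apply: cos_lt1; rewrite -mulrN opprB /k.
  have b0' : 0 < b by lra.
  apply/andP; split; first by rewrite mulr_gt0// divr_gt0// mulr_gt0.
  by rewrite mulrAC ltr_pdivrMr// ltr_pM2l// mulr_gt0.
have : C = 0 by have /eqP := CE; nra.
move=> /eqP; rewrite /C mulf_eq0 invr_eq0 (negbTE k0) orbF mulf_eq0 pnatr_eq0/=.
by move=> /eqP <-; congr sin; rewrite /k; field.
Qed.

End sum_of_uniforms.

(** * Lebesgue measure under reflections, and atomlessness *)

Section lebesgue.
Context {R : realType}.
Local Notation mu := (@lebesgue_measure R).

(** Uniqueness of Lebesgue measure: the image measure gives half-open intervals their length, since
    their preimages are half-open intervals of the same length, closed at the other end. *)
Lemma lebesgue_measure_reflect (s : R) (A : set R) : measurable A ->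
  mu ((fun x => s - x) @^-1` A) = mu A.
Proof.
pose phi : measurableTypeR R -> measurableTypeR R := fun x => s - x.
have mphi : measurable_fun setT phi.
  exact: (measurable_funB (measurable_cst s) (@measurable_id _ R setT)).
move=> mA; apply/esym.
have := @lebesgue_measure_unique R (pushforward mu phi).
move=> /(_ mphi _ A mA) -> //= _ [[x y]] _ <-.
rewrite /pushforward/=.
have -> : (fun x => s - x) @^-1` `]x, y] = `[s - y, s - x[%classic.
  apply/seteqP; split => z/=; rewrite !in_itv/= => /andP[? ?];
    by apply/andP; split; lra.
rewrite !lebesgue_measure_itv/= !lte_fin ltrD2l ltrN2 -!EFinD.
by case: ifP => // _; congr EFin; ring.
Qed.

(** The half-open interval is used because it is tiled exactly by half-open blocks; dropping the
    endpoint [1] changes no integral. *)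
Lemma uniform01E (A : set R) : measurable A ->
  uniform_prob (@ltr01 R) A = mu (A `&` `[0, 1[).
Proof.
move=> mA; have mI : measurable_fun setT (EFin \o (\1_A : R -> R)).
  by apply/measurable_EFinP; exact: measurable_indic.
rewrite -[X in uniform_prob _ X = _]setIT -integral_indic//= integral_uniform//.
rewrite subr0 invr1 mul1e -integral_itv_bndo_bndc; last exact: measurable_funTS.
by rewrite integral_indic.
Qed.

(** The map is [s - x] on [E] and [t - x] off [E]. Each piece of [I] is stable under its own
    reflection, so measure is preserved on each piece; the reverse inclusions hold because
    reflections are involutions. *)
Lemma piecewise_reflection_preserving (E I A : set R) (s t : R) :
  measurable E -> measurable I -> measurable A ->
  (forall x, E x -> E (s - x)) -> (forall x, ~ E x -> ~ E (t - x)) ->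
  (forall x, E x -> I x -> I (s - x)) ->
  (forall x, ~ E x -> I x -> I (t - x)) ->
  mu ((fun x => t - x - (t - s) * \1_E x) @^-1` A `&` I) = mu (A `&` I).
Proof.
move=> mE mI mA Es Et Is It.
have split_mu (B : set R) : measurable B ->
    mu B = (mu (B `&` E) + mu (B `&` ~` E))%E.
  move=> mB; rewrite -measureU//; first by rewrite -setIUr setUv setIT.
  - exact: measurableI.
  - by apply: measurableI => //; exact: measurableC.
  - by rewrite setIACA setICr setI0.
have mS : measurable_fun setT (fun x : R => t - x - (t - s) * \1_E x).
  apply: measurable_funB; first exact: measurable_funB.
  by apply: measurable_funM => //; exact: measurable_indic.
have mSA : measurable ((fun x => t - x - (t - s) * \1_E x) @^-1` A).
  by rewrite -[X in measurable X]setTI; exact: mS.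
have SE x : E x -> t - x - (t - s) * \1_E x = s - x.
  by move=> Ex; rewrite indicE mem_set//= mulr1; ring.
have SnE x : ~ E x -> t - x - (t - s) * \1_E x = t - x.
  by move=> Ex; rewrite indicE memNset//= mulr0 subr0.
rewrite split_mu ?[RHS]split_mu; [|exact: measurableI..].
congr (_ + _)%E.
- rewrite -[RHS](lebesgue_measure_reflect s); last by do 2?apply: measurableI.
  congr (mu _); apply/seteqP; split => x /= [[+ Ix] Ex].
  + by rewrite SE// => Ax; split; [split=> //; exact: Is|exact: Es].
  + have Ex' : E x by rewrite -(subKr s x); exact: Es.
    rewrite (SE x)// => Ax; split=> //; split=> //.
    by rewrite -(subKr s x); exact: Is.
- rewrite -[RHS](lebesgue_measure_reflect t); last first.
    by do 2?apply: measurableI => //; exact: measurableC.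
  congr (mu _); apply/seteqP; split => x /= [[+ Ix] Ex].
  + by rewrite SnE// => Ax; split; [split=> //; exact: It|exact: Et].
  + have Ex' : ~ E x by rewrite -(subKr t x); exact: Et.
    rewrite (SnE x)// => Ax; split=> //; split=> //.
    by rewrite -(subKr t x); exact: It.
Qed.

Lemma atomless_uniform01 : atomless (uniform_prob (@ltr01 R)).
Proof.
move=> A mA A0; pose P := uniform_prob (@ltr01 R).
have Afin : P A \is a fin_num by exact: fin_num_measure.
have r0 : 0 < fine (P A) by rewrite fine_gt0// A0 ltey_eq Afin.
(* The mesh [1 / (n + 1)] is taken finer than the mass of [A], so that any piece of [A] within one
   mesh interval has strictly smaller mass. *)
have [n nr] : exists n : nat, n.+1%:R^-1 < fine (P A).
  exists (Num.trunc (fine (P A))^-1).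
  rewrite -[ltRHS]invrK ltf_pV2 ?posrE ?invr_gt0//.
  exact: truncnS_gt.
pose J (k : nat) : set R := `[k%:R / n.+1%:R, k.+1%:R / n.+1%:R[%classic.
pose B k := A `&` J k.
have mB k : measurable (B k) by apply: measurableI => //; exact: measurable_itv.
(* A meets some interval shorter than its measure in a non-null set. *)
have [k Bk] : exists k, P (B k) <> 0%E.
  apply: contrapT => /forallNP B0.
  suff : P A = 0%E by move=> PA0; move: r0; rewrite PA0 ltxx.
  rewrite /P uniform01E//.
  have N0 : mu.-negligible (\bigcup_k (B k `&` `[0, 1[)).
    apply: negligible_bigcup => k; apply/negligibleP; first exact: measurableI.
    transitivity (P (B k)); first exact: (esym (uniform01E (mB k))).
    by apply: contrapT; exact: B0.
  apply/negligibleP; first exact: measurableI.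
  apply: negligibleS N0 => x [Ax x01]; exists (Num.trunc (x * n.+1%:R)) => //.
  split=> //; split=> //; move: x01; rewrite /J /= !in_itv/= => /andP[x0 x1].
  rewrite ler_pdivrMr// ltr_pdivlMr//.
  by apply: truncn_itv; rewrite mulr_ge0.
exists (B k); split => //; first by move=> x [].
  by rewrite lt0e measure_ge0 andbT; apply/eqP.
have PBk : (P (B k) <= mu (J k))%E.
  apply: (@le_trans _ _ (mu (B k `&` `[0, 1[))).
    by rewrite -(uniform01E (mB k)).
  apply: le_measure; rewrite ?inE;
    [exact: measurableI|exact: measurable_itv|by move=> x [[]]].
apply: (le_lt_trans PBk); rewrite -[ltRHS](fineK Afin).
apply: (@le_lt_trans _ _ (n.+1%:R^-1)%:E); last by rewrite lte_fin.
rewrite /J lebesgue_measure_itv/=; case: ifP => _; last first.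
  by rewrite lee_fin invr_ge0.
by rewrite -EFinD lee_fin -mulrBl -natrB// subSnn mul1r.
Qed.

Lemma measurable_floor (f : R -> R) : measurable_fun setT f ->
  measurable_fun setT (fun x => (Num.floor (f x))%:~R : R).
Proof.
move=> mf.
have mfloor : measurable_fun setT (fun y : R => (Num.floor y)%:~R : R).
  apply: nondecreasing_measurable => // x y xy.
  by rewrite ler_int; exact: le_floor.
exact: measurableT_comp mfloor mf.
Qed.

End lebesgue.

(** * Sufficiency: the block-reflecting coupling *)

Section block_reflection.
Context {R : realType}.
Variables (a b : R) (n : nat).
Hypothesis n_gt0 : (0 < n)%N.
Hypothesis bn : b * n%:R = 1.
Hypothesis a_lt1 : 0 < 1 - a < b.

(** With [k] and [l] the indices of the length-[b] blocks of [x] and [a - x],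
    this says [k + l = n - 1], i.e. the two blocks are mirror images in [[0, 1[];
    otherwise [k + l = n - 2] and [a + b - x] is in the mirror block. *)
Definition mirror_blocks : set R :=
  [set x | Num.floor (x * n%:R) + Num.floor ((a - x) * n%:R) = n%:Z - 1].

(** The sum of the floors is an integer in the interval from [a * n - 2] (excluded) to [a * n], and
    [n - 1 < a * n < n] because [0 < 1 - a < b = 1 / n]. *)
Lemma floor_reflect (x : R) :
  Num.floor (x * n%:R) + Num.floor ((a - x) * n%:R) = n%:Z - 1 \/
  Num.floor (x * n%:R) + Num.floor ((a - x) * n%:R) = n%:Z - 2.
Proof.
have /andP[] := floor_itv (x * n%:R).
have /andP[] := floor_itv ((a - x) * n%:R).
set p := Num.floor (x * n%:R); set q := Num.floor _.
rewrite !intrD => q1 q2 p1 p2.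
have n0 : 0 < n%:R :> R by rewrite ltr0n.
move: a_lt1 (bn) => /andP[a1 ab] bnE.
have h1 : 0 < n%:R * (a + b - 1) by rewrite mulr_gt0//; lra.
have h2 : 0 < n%:R * (1 - a) by rewrite mulr_gt0.
have l1 : ((p + q)%:~R < n%:Z%:~R :> R) by rewrite -pmulrn intrD; lra.
have l2 : ((n%:Z - 3)%:~R < (p + q)%:~R :> R).
  by rewrite intrB -pmulrn intrD; lra.
move: l1 l2; rewrite !ltr_int; lia.
Qed.

Lemma floor_shift (x : R) :
  Num.floor ((a + b - x) * n%:R) = Num.floor ((a - x) * n%:R) + 1.
Proof.
have -> : (a + b - x) * n%:R = (a - x) * n%:R + 1 by move: bn; lra.
by rewrite floorDrz ?floor1.
Qed.

Lemma itv01_floor (x : R) :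
  `[0, 1[%classic x <-> (0 <= Num.floor (x * n%:R) < n%:Z)%R.
Proof.
have n0 : 0 < n%:R :> R by rewrite ltr0n.
rewrite /= in_itv/= floor_ge0 pmulr_lge0// -(ltr_pM2r n0) mul1r.
by rewrite -(floor_lt_int _ n%:Z).
Qed.

Lemma mirror_blocks_reflect x : mirror_blocks x -> mirror_blocks (a - x).
Proof. by rewrite /mirror_blocks/= => <-; rewrite subKr addrC. Qed.

(** Since [b * n = 1], passing from [x] to [a + b - x] swaps the two floors up to shifts by [1] and
    [-1], which cancel in the sum. *)
Lemma not_mirror_blocks_reflect x :
  ~ mirror_blocks x -> ~ mirror_blocks (a + b - x).
Proof.
rewrite /mirror_blocks/=; apply: contra_not; rewrite floor_shift => <-.
have -> : (a - (a + b - x)) * n%:R = x * n%:R - 1 by move: bn; lra.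
by rewrite floorDrz ?rpredN ?rpred1// floorN ?rpred1// floor1; ring.
Qed.

Lemma mirror_blocks_itv x :
  mirror_blocks x -> `[0, 1[%classic x -> `[0, 1[%classic (a - x).
Proof.
rewrite /mirror_blocks/= => Ex /itv01_floor x01; apply/itv01_floor.
move: Ex x01; move: (Num.floor _) (Num.floor _) => p q; lia.
Qed.

(** Off the mirror set the indices satisfy [k + l = n - 2], and the extra [b] raises [l] by one. So
    [a + b - x] has index [n - 1 - k], again between [0] and [n - 1]. *)
Lemma not_mirror_blocks_itv x :
  ~ mirror_blocks x -> `[0, 1[%classic x -> `[0, 1[%classic (a + b - x).
Proof.
move=> Ex /itv01_floor x01; apply/itv01_floor; rewrite floor_shift.
have [//|] := floor_reflect x.
move: x01; move: (Num.floor _) (Num.floor _) => p q; lia.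
Qed.

Lemma measurable_mirror_blocks : measurable mirror_blocks.
Proof.
have -> : mirror_blocks = (fun x : R => (Num.floor (x * n%:R))%:~R +
    (Num.floor ((a - x) * n%:R))%:~R : R) @^-1` [set (n%:Z - 1)%:~R].
  apply/seteqP; split => x; rewrite /mirror_blocks/= -intrD; first by move=> ->.
  by move/eqP; rewrite eqr_int => /eqP.
rewrite -[X in measurable X]setTI.
have mf : measurable_fun setT (fun x : R => (Num.floor (x * n%:R))%:~R +
    (Num.floor ((a - x) * n%:R))%:~R : R).
  apply: measurable_funD; apply: measurable_floor; apply: measurable_funM => //.
  exact: measurable_funB.
exact: (mf measurableT).
Qed.

(** This is [a - x] on the mirror set and [a + b - x] elsewhere; the indicator form gives
    measurability directly and fits the piecewise reflection with [s = a], [t = a + b]. *)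
Definition block_reflection (x : R) : R := a + b - x - b * \1_mirror_blocks x.

Lemma measurable_block_reflection : measurable_fun setT block_reflection.
Proof.
apply: measurable_funB; first exact: measurable_funB.
apply: measurable_funM => //; apply: measurable_indic.
exact: measurable_mirror_blocks.
Qed.

Lemma block_reflectionD x : [set a; a + b] (x + block_reflection x).
Proof.
rewrite /block_reflection indicE; case: (x \in mirror_blocks) => /=.
- by left; ring.
- by right; ring.
Qed.

Lemma uniform01_block_reflection (A : set R) : measurable A ->
  uniform_prob (@ltr01 R) (block_reflection @^-1` A) =
  uniform_prob (@ltr01 R) A.
Proof.
move=> mA.
have mSA : measurable (block_reflection @^-1` A).
  by rewrite -[X in measurable X]setTI; exact: measurable_block_reflection.
rewrite !uniform01E//.
have := @piecewise_reflection_preserving R mirror_blocks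
  `[0, 1[%classic A a (a + b) measurable_mirror_blocks
  (measurable_itv _) mA mirror_blocks_reflect
  not_mirror_blocks_reflect mirror_blocks_itv not_mirror_blocks_itv.
by rewrite /block_reflection (_ : a + b - a = b)//; ring.
Qed.

End block_reflection.

(** * Role of the mean, and the equivalence *)

Section bi_atomic_laws.
Context {R : realType}.

(** With [q] the mass at [a + b], the mean condition reads [1 - a = b * q], and [0 < q < 1] since
    both atoms are charged. *)
Lemma bi_atomic_mean_bounds (F : probability R R) (a b : R) : 0 < b ->
  bi_atomic F a (a + b) -> ('E_F[fun x : R => x] = 1)%E -> 0 < 1 - a < b.
Proof.
move=> b0 [ab F1 Fa Fab]; rewrite (two_point_mean F1).
move: Fa; rewrite (two_point_left ab F1).
have Ffin : F [set a + b] \is a fin_num by exact: fin_num_measure.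
rewrite -(fineK Ffin) in Fab *; set q := fine _ in Fab *.
rewrite sube_gt0 -EFinM -EFinD lte_fin => q1 [] m.
by rewrite lte_fin in Fab; apply/andP; split; nra.
Qed.

Lemma law_sum_two_point {d : measure_display} {T : measurableType d}
    (P : probability T R) (X1 X2 : {RV P >-> R}) (F : probability R R)
    (a b : R) :
  0 < b -> bi_atomic F a (a + b) -> ('E_F[fun x : R => x] = 1)%E ->
  uniform01 P X1 -> uniform01 P X2 ->
  (forall w, [set a; a + b] (X1 w + X2 w)) -> has_law P (X1 \+ X2) F.
Proof.
move=> b0 [ab F1 Fa Fab] Fm u1 u2 X12.
pose nu : probability R R := distribution P (X1 \+ X2).
have nu1 : nu [set a; a + b] = 1%E.
  rewrite /nu/= /distribution/= /pushforward -[RHS](probability_setT P).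
  by congr (P _); apply/seteqP; split => // w _; exact: X12.
have EX (X : {RV P >-> R}) : uniform01 P X -> ('E_P[X] = (1 / 2 : R)%:E)%E.
  move=> uX; rewrite -integral01_id.
  by rewrite -(expectation_uniform01 (f := id) uX).
have LX (X : {RV P >-> R}) : uniform01 P X -> (X : T -> R) \in Lfun P 1.
  by move=> uX; apply: (Lfun1_uniform01 (f := id) uX) => x; exact: cvg_id.
have num : ('E_nu[fun x : R => x] = 1)%E.
  rewrite unlock -(integral_pushforward_eq (P := P) (mu := nu) (f := EFin)
    (measurable_funPT (X1 \+ X2)))//.
  transitivity ('E_P[X1 \+ X2])%E; first by rewrite unlock.
  by rewrite expectationD ?LX// !EX// -EFinD; congr EFin; field.
apply: (two_point_eq ab nu1 F1).
move: num; rewrite (two_point_mean nu1) -[in RHS]Fm (two_point_mean F1).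
have Ffin : F [set a + b] \is a fin_num by exact: fin_num_measure.
have nufin : nu [set a + b] \is a fin_num by exact: fin_num_measure.
(* Both means have the form [a + b * q]; cancelling [a] and then [b] identifies the masses at
   [a + b]. *)
rewrite -(fineK Ffin) -(fineK nufin) -!EFinM -!EFinD => -[] /addrI.
by move=> /(mulfI (lt0r_neq0 b0)) ->.
Qed.

End bi_atomic_laws.

Unset Implicit Arguments.

Theorem theorem3p4 (R : realType) (a b : R) (b_gt0 : 0 < b)
    (F : probability R R)
    (F_bi_atomic : bi_atomic F a (a + b))
    (F_mean : ('E_F[fun x : R => x] = 1)%E) :
  DU2 R F <-> exists n : nat, (0 < n)%N /\ 1 / b = n%:R.
Proof.
have a_lt1 := bi_atomic_mean_bounds b_gt0 F_bi_atomic F_mean.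
split=> [[d [T [P [X1 [X2 [_ u1 u2 XF]]]]]]|[n [n0 bn]]].
  apply: sin_pi_nat; first by rewrite divr_gt0.
  rewrite div1r; apply: (two_point_sum_sin_eq0 a_lt1 u1 u2).
  by have [_ <- _ _] := F_bi_atomic; rewrite -XF//; exact: measurableU.
have bn1 : b * n%:R = 1 by rewrite -bn; field; exact: lt0r_neq0.
(* The real line under the uniform law is itself the atomless space; [X1] is the identity and [X2]
   the block reflection. *)
pose P : probability (measurableTypeR R) R := uniform_prob (@ltr01 R).
have m1 : measurable_fun setT (idfun : measurableTypeR R -> R).
  exact: (@measurable_id _ R setT).
have m2 : measurable_fun setT
    (block_reflection a b n : measurableTypeR R -> R).
  exact: measurable_block_reflection.
pose X1 : {RV P >-> R} := @mfun_Sub _ _ (measurableTypeR R) R _ (mem_set m1).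
pose X2 : {RV P >-> R} := @mfun_Sub _ _ (measurableTypeR R) R _ (mem_set m2).
exists _, (measurableTypeR R), P, X1, X2.
have u1 : uniform01 P X1 by [].
have u2 : uniform01 P X2.
  by move=> A mA; exact: (uniform01_block_reflection n0 bn1 a_lt1 mA).
split=> //; first exact: atomless_uniform01.
apply: (law_sum_two_point b_gt0 F_bi_atomic F_mean u1 u2) => w.
exact: block_reflectionD.
Qed.
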